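(* Let $|z|<1$ and $a\in\mathbb{R}\setminus\frac{1}{2}\mathbb{Z}_{\le 0}$. Then \[ \Phi_{HCB}(1,a,z)=\frac{4^a}{\binom{2a}{a}a}\cdot\frac{z^{2a}}{\sqrt{1-z^2}}\;{}_2F_1\!\left(\begin{matrix}\frac12,\,a-\frac12\\ a+\frac12\end{matrix};z^2\right). \]
   Context: For $|z|<1$ and real $a$ not a non-positive half-integer, $\Phi_{HCB}(s,a,z):=\sum_{n=0}^{\infty}\frac{(2z)^{2(n+a)}}{\binom{2(n+a)}{n+a}(n+a)^s}$, with $\binom{x}{y}:=\frac{\Gamma(x+1)}{\Gamma(y+1)\Gamma(x-y+1)}$ for real $x,y$. ${}_2F_1\!\left(\begin{matrix}\alpha,\beta\\ \gamma\end{matrix};z\right)=\sum_{n\ge0}\frac{(\alpha)_n(\beta)_n}{(\gamma)_n n!}z^n$ is the Gauss hypergeometric series, with $(\alpha)_n=\Gamma(\alpha+n)/\Gamma(\alpha)$. *)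

(* Defs.v *)
From HB Require Import structures.
From mathcomp Require Import all_boot all_order all_algebra.
From mathcomp Require Import complex.
From mathcomp Require Import all_classical all_reals all_analysis.

Set Implicit Arguments.
Unset Strict Implicit.
Unset Printing Implicit Defensive.

Import Order.TTheory GRing.Theory Num.Theory.
Import numFieldNormedType.Exports.

Local Open Scope classical_set_scope.
Local Open Scope ring_scope.
Local Open Scope complex_scope.

Section RealSpecialFunctions.
Context {R : realType}.
Implicit Types x y alpha : R.

Definition gamma_integral x : R :=
  \int[@lebesgue_measure R]_(t in `]0, +oo[) (t `^ (x - 1) * expR (- t)).

(* For x <= 0 this is the extension by Gamma (x + 1) = x * Gamma x, where n is
   the least natural number with 0 < x + n. At the poles 0, -1, -2, ... one
   factor of the product vanishes, so that Gamma takes the junk value 0. *)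
Definition Gamma x : R :=
  let n := if 0 < x then 0%N else (Num.truncn (- x)).+1 in
  gamma_integral (x + n%:R) / \prod_(k < n) (x + k%:R).

Definition gbinom x y : R :=
  Gamma (x + 1) / (Gamma (y + 1) * Gamma (x - y + 1)).

(* When alpha is a pole of Gamma, the quotient of Gamma values is understood
   as its continuous extension in alpha, the rising factorial; in particular
   pochhammer 0 n is 1 if n = 0 and 0 otherwise. *)
Definition pochhammer alpha (n : nat) : R :=
  if `[< exists m : nat, alpha = - m%:R >]
  then \prod_(k < n) (alpha + k%:R)
  else Gamma (alpha + n%:R) / Gamma alpha.

End RealSpecialFunctions.

Section ComplexPower.
Context {R : realType}.
Implicit Types z w : R[i].

Definition cexp z : R[i] :=
  (expR (complex.Re z))%:C * (cos (complex.Im z) +i* sin (complex.Im z)).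

(* Principal argument, with values in ]-pi, pi] *)
Definition carg z : R :=
  let t := acos (complex.Re z / complex.Re `|z|) in
  if 0 <= complex.Im z then t else - t.

Definition clog z : R[i] := ln (complex.Re `|z|) +i* carg z.

(* Principal branch, with 0 ^ 0 = 1 and 0 ^ w = 0 for w != 0 *)
Definition cpow z w : R[i] :=
  if z == 0 then (w == 0)%:R else cexp (w * clog z).

(* Not sqrtC, which takes its values in the upper half-plane and hence differs
   from the principal square root when Im z < 0. *)
Definition csqrt z : R[i] := cpow z (2^-1)%:C.

End ComplexPower.

(* The topology of the complex numbers is that of the regular module R[i]^o. *)

Section Series.
Context {R : realType}.
Implicit Types (s z : R[i]) (a alpha beta gamma : R).

Definition HCB_term s a z (n : nat) : R[i]^o :=
  cpow (2 * z) (2 * (n%:R + a))%:C /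
  ((gbinom (2 * (n%:R + a)) (n%:R + a))%:C * cpow (n%:R + a)%:C s).

Definition Phi_HCB s a z : R[i] := limn (series (HCB_term s a z)).

Definition hyp2F1_term alpha beta gamma z (n : nat) : R[i]^o :=
  (pochhammer alpha n * pochhammer beta n
     / (pochhammer gamma n * n`!%:R))%:C * z ^+ n.

Definition hyp2F1 alpha beta gamma z : R[i] :=
  limn (series (hyp2F1_term alpha beta gamma z)).

End Series.

(* Main.v *)
Require Import Defs.
From HB Require Import structures.
From mathcomp Require Import all_boot all_order all_algebra.
From mathcomp Require Import complex.
From mathcomp Require Import all_classical all_reals all_analysis.
From mathcomp Require Import ring lra.
From mathcomp Require Import measurable_realfun.

Import Order.TTheory GRing.Theory Num.Theory.
Import numFieldNormedType.Exports.

Local Open Scope classical_set_scope.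
Local Open Scope ring_scope.
Local Open Scope complex_scope.

(* Put w = z^2, x = a - 1/2 and b_n = (1/2)_n / n!. By the functional equation
   of Gamma the series Phi_HCB is, up to the prefactor of the theorem without
   the square root, the sum of e_n w^n with e_n = (a)_n / (a + 1/2)_n. The
   hypergeometric series has coefficients b_n g_n with
   g_n = (x)_n / (x + 1)_n, where (x + n) g_n = x, and the recurrences of b and g
   give by induction that e is the Cauchy product of b g and b. In the same way
   b * b is constantly 1, so the sum B of b_n w^n satisfies (1 - w) B^2 = 1; as
   moreover Re ((1 - w) B) > 0, B is the inverse of the principal square root
   of 1 - w. *)

(** * The Gamma integral: finiteness, positivity, functional equation *)

Section GammaIntegral.
Context {R : realType}.
Implicit Types (x t : R).
Notation mu := (@lebesgue_measure R).

Let gamma_integrand x t : R := t `^ (x - 1) * expR (- t).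
(* For x < 1 the integrand is singular at 0; integration by parts is done on
   these segments, which exhaust ]0, +oo[. *)
Let segment n : set R := `[n.+2%:R^-1, n.+2%:R]%classic.

Lemma gamma_integrand_ge0 x t : 0 <= gamma_integrand x t.
Proof. by rewrite mulr_ge0 ?powR_ge0 ?expR_ge0. Qed.

Lemma powR_continuous x t : 0 < t -> {for t, continuous (fun u : R => u `^ x)}.
Proof.
move=> t0; apply: differentiable_continuous; apply/derivable1_diffP.
by apply: derivable_powR; rewrite in_itv/= t0.
Qed.

Lemma expRN_continuous t : {for t, continuous (fun u : R => expR (- u))}.
Proof.
apply: continuous_comp; first exact: (@continuousN _ R^o _ id).
exact: continuous_expR.
Qed.

Lemma gamma_integrand_continuous x t : 0 < t -> {for t, continuous (gamma_integrand x)}.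
Proof.
move=> t0; apply: continuousM; first exact: powR_continuous.
exact: expRN_continuous.
Qed.

Lemma segment_gt0 n t : segment n t -> 0 < t.
Proof.
by rewrite /segment/= in_itv/= => /andP[+ _]; apply: lt_le_trans; rewrite invr_gt0.
Qed.

Lemma bigcup_segment : \bigcup_n segment n = `]0, +oo[%classic.
Proof.
apply/seteqP; split=> [t [n _ /segment_gt0 t0]|t]; rewrite /= in_itv/= andbT// => t0.
(* This index exceeds, up to the shift by 2, both t and 1/t, so t lies between the endpoints. *)
exists (Num.truncn (t + t^-1)) => //.
have ut : t + t^-1 < (Num.truncn (t + t^-1)).+2%:R.
  have := truncnS_gt (t + t^-1); rewrite [in X in _ -> X]mulrS.
  by move=> /lt_trans -> //; rewrite ltrDr.
have t'0 : 0 < t^-1 by rewrite invr_gt0.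
rewrite /segment/= in_itv/=; apply/andP; split; last first.
  by apply: ltW; apply: lt_trans ut; rewrite ltrDl.
rewrite invf_ple ?posrE//.
by apply: ltW; apply: lt_trans ut; rewrite ltrDr.
Qed.

Lemma measurable_gamma_integrand x :
  measurable_fun (`]0, +oo[%classic : set R) (gamma_integrand x).
Proof.
apply: subspace_continuous_measurable_fun => /=; first exact: measurable_itv.
apply: continuous_in_subspaceT => t; rewrite inE/= in_itv/= andbT.
exact: gamma_integrand_continuous.
Qed.

Lemma integral_segment_cvg x :
  (\int[mu]_(t in segment n) (gamma_integrand x t)%:E @[n --> \oo] -->
   \int[mu]_(t in `]0%R, +oo[) (gamma_integrand x t)%:E)%E.
Proof.
rewrite -bigcup_segment; apply: ge0_nondecreasing_set_cvg_integral.
- apply/nondecreasing_seqP => n; rewrite subsetEset => t; rewrite /segment/= !in_itv/=.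
  move=> /andP[t1 t2]; apply/andP; split.
    by apply: le_trans t1; rewrite lef_pV2 ?posrE// ler_nat.
  by apply: le_trans t2 _; rewrite ler_nat.
- by move=> n; exact: measurable_itv.
- move=> n; apply/measurable_EFinP.
  apply: (measurable_funS _ _ (measurable_gamma_integrand x)) => //.
  by move=> t /segment_gt0 t0; rewrite /= in_itv/= t0.
- by move=> n t _; rewrite lee_fin gamma_integrand_ge0.
Qed.

(** With u = t / (2x), t^x = (2x)^x u^x and u <= 1 + u <= e^u. The rate 1/2 leaves a decaying factor
    e^(-t/2) after multiplication by e^(-t). *)
Lemma powR_le_expR x t : 0 < x -> 0 < t ->
  t `^ x <= (2 * x) `^ x * expR (2^-1 * t).
Proof.
move=> x0 t0.
have x20 : 0 < 2 * x by rewrite mulr_gt0.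
rewrite [in leLHS](_ : t = (2 * x) * (t / (2 * x))); last by field; rewrite gt_eqF.
rewrite powRM; [|lra|by rewrite divr_ge0// ltW].
rewrite ler_pM2l ?powR_gt0//.
have -> : 2^-1 * t = (t / (2 * x)) * x by field; rewrite gt_eqF.
rewrite expRM; apply: ge0_ler_powR; rewrite ?nnegrE ?expR_ge0 ?divr_ge0 ?ltW//.
by apply: lt_le_trans (expR_ge1Dx _); rewrite ltrDr.
Qed.

Lemma integral_segmentS x n : 0 < x ->
  (\int[mu]_(t in segment n) (gamma_integrand (x + 1) t)%:E =
  (n.+2%:R^-1 `^ x * expR (- n.+2%:R^-1) - n.+2%:R `^ x * expR (- n.+2%:R))%:E
  + x%:E * \int[mu]_(t in segment n) (gamma_integrand x t)%:E)%E.
Proof.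
move=> x0.
have ab : n.+2%:R^-1 < n.+2%:R :> R.
  by apply: (@lt_trans _ _ 1); rewrite ?invf_lt1 ?ltr1n.
have a0 : 0 < n.+2%:R^-1 :> R by rewrite invr_gt0.
have b0 : 0 < n.+2%:R :> R by [].
have segment_cont (f : R -> R) : (forall t, 0 < t -> {for t, continuous f}) ->
    {within segment n, continuous f}.
  by move=> cf; apply: continuous_in_subspaceT => t; rewrite inE => /segment_gt0/cf.
have segment_deriv (f : R -> R) : (forall t, 0 < t -> {for t, continuous f}) ->
    (forall t, 0 < t -> derivable f t 1) ->
    derivable_oo_LRcontinuous f n.+2%:R^-1 n.+2%:R.
  move=> cf df; split.
  - by move=> t; rewrite in_itv/= => /andP[t0 _]; apply: df; exact: lt_trans t0.
  - by apply: cvg_at_right_filter; exact: cf.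
  - by apply: cvg_at_left_filter; exact: cf.
have igf : mu.-integrable (segment n) (EFin \o gamma_integrand x).
  apply: continuous_compact_integrable; first exact: segment_compact.
  by apply: segment_cont => t; exact: gamma_integrand_continuous.
have igh : mu.-integrable (segment n)
    (EFin \o (fun t => x * t `^ (x - 1) * - expR (- t))).
  apply: continuous_compact_integrable; first exact: segment_compact.
  apply: segment_cont => t t0; apply: continuousM.
    by apply: continuousM; [exact: cst_continuous|exact: powR_continuous].
  by apply: (@continuousN _ R^o); exact: expRN_continuous.
rewrite -integralZl//; last exact: measurable_itv.
have := @integration_by_parts R (fun t => t `^ x) (fun t => - expR (- t))
  (fun t => x * t `^ (x - 1)) (fun t => expR (- t)) _ _ ab _ _ _ _ _ _.
rewrite /gamma_integrand addrK => ->.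
- congr (_ + _)%E; first by congr EFin; ring.
  rewrite -integralN/=.
    by apply: eq_integral => t _; rewrite -EFinM mulrN opprK mulrA.
  exact: integrable_add_def.
- by apply: segment_cont => t t0; apply: continuousM; [exact: cst_continuous|exact: powR_continuous].
- apply: segment_deriv => t t0; first exact: powR_continuous.
  by apply: derivable_powR; rewrite in_itv/= t0.
- move=> t; rewrite in_itv/= => /andP[t0 _].
  by rewrite powR_derive1// in_itv/= andbT; exact: lt_trans t0.
- by apply: segment_cont => t _; exact: expRN_continuous.
- apply: segment_deriv => t _; first by apply: (@continuousN _ R^o); exact: expRN_continuous.
  exact: ex_derive.
- move=> t _; rewrite derive1E; apply: (@derive_val _ _ _ _ _ _ _ _).
  have h : is_derive t 1 (fun u : R => expR (- u)) (expR (- t) * - 1).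
    by apply: (@is_derive1_comp _ expR -%R); exact: is_deriveN.
  by apply: (is_derive_eq (is_deriveN h)); rewrite mulrN1 opprK.
Qed.

Lemma cvgr_addn2 : (n.+2%:R : R) @[n --> \oo] --> +oo.
Proof.
apply/cvgryPge => M; near=> n.
apply: (@le_trans _ _ n%:R); first by near: n; exact: nbhs_infty_ger.
by rewrite ler_nat -addn2 leq_addr.
Unshelve. all: by end_near. Qed.

Lemma powR_expRN_cvg0 x : 0 < x ->
  n.+2%:R `^ x * expR (- n.+2%:R) @[n --> \oo] --> (0 : R).
Proof.
move=> x0.
have h : (2 * x) `^ x * expR (- (2^-1 * n.+2%:R)) @[n --> \oo] --> (0 : R).
  rewrite -[X in _ --> X](mulr0 ((2 * x) `^ x)); apply: cvgMr.
  apply: (cvg_comp (fun n : nat => 2^-1 * n.+2%:R : R) (fun t => expR (- t))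
    _ (@cvgr_expR R)).
  apply: (cvg_comp (fun n : nat => n.+2%:R : R) (fun t => 2^-1 * t) cvgr_addn2).
  by apply: gt0_cvgMry; first by rewrite invr_gt0.
apply: (squeeze_cvgr _ (cvg_cst _) h); near=> n.
rewrite mulr_ge0 ?powR_ge0 ?expR_ge0//=.
apply: (@le_trans _ _ ((2 * x) `^ x * expR (2^-1 * n.+2%:R) * expR (- n.+2%:R))).
  by rewrite ler_pM2r ?expR_gt0// powR_le_expR.
by rewrite -mulrA -expRD ler_pM2l ?powR_gt0 ?mulr_gt0// ler_expR; lra.
Unshelve. all: by end_near. Qed.

Lemma powR_expRV_cvg0 x : 0 < x ->
  n.+2%:R^-1 `^ x * expR (- n.+2%:R^-1) @[n --> \oo] --> (0 : R).
Proof.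
move=> x0.
have h : n.+2%:R^-1 `^ x @[n --> \oo] --> (0 : R).
  have /cvg_at_rightP := powR_cvg0 x0; apply; split.
    by move=> n; rewrite invr_gt0.
  apply: (iffRL (@gtr0_cvgV0 _ _ _ _ (fun n : nat => n.+2%:R : R) _) cvgr_addn2).
  by near=> n.
apply: (squeeze_cvgr _ (cvg_cst _) h); near=> n.
rewrite mulr_ge0 ?powR_ge0 ?expR_ge0//= ler_piMr ?powR_ge0//.
Unshelve. all: by end_near. Qed.

(* Stated in \bar R, where it needs no integrability; finiteness at x then
   follows from finiteness at x + 1, where there is no singularity at 0. *)
Lemma integral_gamma_integrandS x : 0 < x ->
  (\int[mu]_(t in `]0%R, +oo[) (gamma_integrand (x + 1) t)%:E =
   x%:E * \int[mu]_(t in `]0%R, +oo[) (gamma_integrand x t)%:E)%E.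
Proof.
move=> x0.
suff : (\int[mu]_(t in segment n) (gamma_integrand (x + 1) t)%:E @[n --> \oo] -->
    x%:E * \int[mu]_(t in `]0%R, +oo[) (gamma_integrand x t)%:E)%E.
  exact: (cvg_unique _ (integral_segment_cvg (x + 1))).
rewrite (eq_cvg _ _ (fun n => integral_segmentS x n x0)).
rewrite -[(x%:E * _)%E]add0e; apply: cvgeD.
- by rewrite fin_num_adde_defr.
- apply: cvg_EFin; first by near=> n.
  rewrite -[X in _ --> X](subrr 0) /=.
  by apply: cvgB; [exact: powR_expRV_cvg0|exact: powR_expRN_cvg0].
- by apply: cvgeZl => //; exact: integral_segment_cvg.
Unshelve. all: by end_near. Qed.

Lemma integral_gamma_integrand_lty x : 0 < x ->
  (\int[mu]_(t in `]0%R, +oo[) (gamma_integrand x t)%:E < +oo)%E.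
Proof.
move=> x0.
suff : (x%:E * \int[mu]_(t in `]0%R, +oo[) (gamma_integrand x t)%:E < +oo)%E.
  apply: contraTT; rewrite -!leNgt !leye_eq => /eqP ->.
  by rewrite gt0_muley// lte_fin.
rewrite -integral_gamma_integrandS//.
(* The integrand at x + 1 is at most (2x)^x e^(-t/2), which is [C] times the exponential density of
   rate 1/2; the factor 2 undoes the normalisation of that density. *)
pose C := 2 * (2 * x) `^ x; have C0 : 0 <= C by rewrite mulr_ge0 ?powR_ge0.
have m0 : measurable (`]0%R, +oo[%classic : set R) by exact: measurable_itv.
have mp (A : set R) : measurable A ->
    measurable_fun A (EFin \o exponential_pdf (2^-1 : R)).
  move=> _; apply/measurable_EFinP; apply: measurable_funTS.
  exact: measurable_exponential_pdf.
apply: (@le_lt_trans _ _ (\int[mu]_(t in `]0%R, +oo[)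
    (C%:E * (exponential_pdf (2^-1 : R) t)%:E))%E).
  apply: ge0_le_integral => //=.
  - by move=> t _; rewrite lee_fin gamma_integrand_ge0.
  - by apply/measurable_EFinP; exact: measurable_gamma_integrand.
  - by apply: measurable_funeM; exact: mp.
  - move=> t; rewrite in_itv/= andbT => t0; rewrite -EFinM lee_fin.
    rewrite (exponential_pdfE _ (ltW t0)) /gamma_integrand addrK /C.
    apply: (@le_trans _ _ ((2 * x) `^ x * expR (2^-1 * t) * expR (- t))).
      by rewrite ler_pM2r ?expR_gt0// powR_le_expR.
    rewrite -mulrA -expRD -mulrA [leRHS]mulrCA ler_pM2l ?powR_gt0 ?mulr_gt0//.
    by rewrite mulrA divff// mul1r ler_expR; lra.
rewrite ge0_integralZl_EFin//=; last 2 first.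
  by move=> t _; rewrite lee_fin exponential_pdf_ge0.
  exact: mp.
apply: (@le_lt_trans _ _ (C%:E * \int[mu]_t (exponential_pdf (2^-1 : R) t)%:E)%E).
  apply: lee_wpmul2l => //.
  apply: ge0_subset_integral => //=; first exact: mp.
  by move=> t _; rewrite lee_fin exponential_pdf_ge0.
by rewrite integral_exponential_pdf ?mule1 ?ltry.
Qed.

Lemma integral_gamma_integrand_gt0 x :
  (0 < \int[mu]_(t in `]0%R, +oo[) (gamma_integrand x t)%:E)%E.
Proof.
(* On [1, 2] both t and ln t are at most 2 and ln t >= 0, so the integrand exp((x - 1) ln t - t) is
   at least [c] whatever the sign of x - 1. *)
pose c := expR (- (`|x - 1| * 2) - 2).
have m12 : measurable (`[1%R, 2%R]%classic : set R) by exact: measurable_itv.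
have s12 : `[1%R, 2%R]%classic `<=` (`]0%R, +oo[%classic : set R).
  by move=> t; rewrite /= !in_itv/= andbT => /andP[+ _]; exact: lt_le_trans.
apply: (@lt_le_trans _ _ (\int[mu]_(t in `[1%R, 2%R]) (cst c%:E t))%E).
  rewrite integral_cst// [X in (_ * X)%E](_ : _ = 1%:E); last first.
    by rewrite /= lebesgue_measure_itv/= lte_fin ltr1n -EFinB; congr EFin; ring.
  by rewrite -EFinM lte_fin mulr1 expR_gt0.
apply: (@le_trans _ _ (\int[mu]_(t in `[1%R, 2%R]) (gamma_integrand x t)%:E)%E).
  apply: ge0_le_integral => //=.
  - by move=> t _; rewrite lee_fin expR_ge0.
  - by apply/measurable_EFinP; apply: (measurable_funS _ s12 (measurable_gamma_integrand x)).
  - move=> t; rewrite in_itv/= => /andP[t1 t2]; rewrite lee_fin.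
    have t0 : 0 < t by lra.
    rewrite /gamma_integrand /powR gt_eqF// -expRD ler_expR lerD//; last by lra.
    have lt0 : 0 <= ln t by exact: ln_ge0.
    have lt2 : ln t <= 2.
      by apply: le_trans t2; rewrite ltW// ln_sublinear.
    rewrite lerNl -mulNr.
    apply: (@le_trans _ _ (`|x - 1| * ln t)).
      by apply: ler_wpM2r => //; rewrite -normrN ler_norm.
    by apply: ler_wpM2l.
apply: ge0_subset_integral => //=.
- by apply/measurable_EFinP; exact: measurable_gamma_integrand.
- by move=> t _; rewrite lee_fin gamma_integrand_ge0.
Qed.

Lemma gamma_integral_gt0 x : 0 < x -> 0 < gamma_integral x.
Proof.
move=> x0; apply: fine_gt0.
by rewrite integral_gamma_integrand_gt0 integral_gamma_integrand_lty.
Qed.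

Lemma gamma_integralS x : 0 < x -> gamma_integral (x + 1) = x * gamma_integral x.
Proof.
move=> x0; rewrite /gamma_integral /Rintegral integral_gamma_integrandS// fineM//.
by rewrite ge0_fin_numE ?integral_gamma_integrand_lty// ltW// integral_gamma_integrand_gt0.
Qed.

End GammaIntegral.

(** * Gamma off its poles, and rising factorials *)

Section GammaFunction.
Context {R : realType}.
Implicit Types x : R.

(** By the functional equation of the integral the quotient is the same for every n that makes the
    argument positive, so the least such n chosen in [Gamma] may be replaced by any other. *)
Lemma Gamma_shift x n : 0 < x + n%:R -> (forall m : nat, x <> - m%:R) ->
  Gamma x = gamma_integral (x + n%:R) / \prod_(k < n) (x + k%:R).
Proof.
move=> xn0 xm.
pose q n := gamma_integral (x + n%:R) / \prod_(k < n) (x + k%:R).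
have qS m k : 0 < x + m%:R -> q (m + k)%N = q m.
  move=> m0; elim: k => [|k <-]; first by rewrite addn0.
  have mk0 : 0 < x + (m + k)%:R by rewrite natrD addrA ltr_wpDr.
  rewrite addnS /q -natr1 addrA gamma_integralS// big_ord_recr/= invfM.
  by rewrite [X in _ * X]mulrC mulrACA divff ?gt_eqF// mul1r.
rewrite /Gamma; set n0 := (if _ then _ else _); rewrite -/(q n0) -/(q n).
have n00 : 0 < x + n0%:R.
  rewrite /n0; case: (ltP 0 x) => [x0|x0]; first by rewrite addr0.
  by rewrite -ltrBlDl sub0r; exact: truncnS_gt.
by have [/subnKC <-|/ltnW/subnKC <-] := leqP n0 n; rewrite qS.
Qed.

(** Shifting x + 1 by n and x by n + 1 gives the same integral; the two products differ by the first
    factor x. *)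
Lemma GammaS x : (forall m : nat, x <> - m%:R) -> Gamma (x + 1) = x * Gamma x.
Proof.
move=> xm; have x0 : x != 0 by apply/eqP; rewrite -oppr0; exact: (xm 0).
have [n xn] : exists n : nat, 0 < x + 1 + n%:R.
  by exists (Num.truncn (- x)).+1; have := truncnS_gt (- x) => ?; lra.
have xm1 m : x + 1 <> - m%:R by move=> e; apply: (xm m.+1); rewrite -natr1; lra.
have e : x + n.+1%:R = x + 1 + n%:R by rewrite -natr1; ring.
rewrite (Gamma_shift _ _ xn xm1) (@Gamma_shift x n.+1) ?e//.
rewrite big_ord_recl addr0 invfM mulrCA mulVKf//.
congr (_ / _); apply: eq_bigr => i _ /=.
by rewrite /bump/= add1n -natr1; ring.
Qed.

Lemma Gamma_neq0 x : (forall m : nat, x <> - m%:R) -> Gamma x != 0.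
Proof.
move=> xm; pose n := (Num.truncn (- x)).+1.
have xn : 0 < x + n%:R by have := truncnS_gt (- x); rewrite -/n => ?; lra.
rewrite (Gamma_shift _ _ xn xm) mulf_neq0//.
  by rewrite gt_eqF// gamma_integral_gt0.
rewrite invr_eq0.
apply/prodf_neq0 => i _; apply/eqP => e; apply: (xm i); lra.
Qed.

(** Off the poles the Gamma quotient telescopes by [GammaS]; at the poles the definition is already
    the product. *)
Lemma pochhammerE x n : pochhammer x n = \prod_(k < n) (x + k%:R).
Proof.
rewrite /pochhammer; case: asboolP => // xm.
have {}xm (m : nat) : x <> - m%:R by move=> e; apply: xm; exists m.
elim: n => [|n IH]; first by rewrite big_ord0 addr0 divff ?Gamma_neq0.
rewrite big_ord_recr/= -IH -natr1 addrA GammaS; first by rewrite -mulrA mulrC.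
by move=> m e; apply: (xm (n + m)%N); rewrite natrD; lra.
Qed.

End GammaFunction.

(** * Convolution identities for the coefficients of (1 - w)^(-1/2) *)

Section HalfConvolution.
Context {F : numFieldType} (b : nat -> F).
Hypothesis b0 : b 0 = 1.
Hypothesis bS : forall n, n.+1%:R * b n.+1 = (n%:R + 2^-1) * b n.

(* With C and B the generating series of c and b, these are the coefficients of
   C B and of C (w B'). *)
Let conv (c : nat -> F) n := \sum_(k < n.+1) c k * b (n - k)%N.
Let wconv (c : nat -> F) n := \sum_(k < n.+1) c k * ((n - k)%:R * b (n - k)%N).

(** The recurrence of [b] reads B' = w B' + B/2; multiply by w C and compare coefficients. *)
Lemma wconvS c n : wconv c n.+1 = wconv c n + 2^-1 * conv c n.
Proof.
rewrite /wconv big_ord_recr/= subnn mul0r mulr0 addr0 mulr_sumr -big_split/=.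
apply: eq_bigr => k _; rewrite subSn; last by rewrite -ltnS.
by rewrite bS mulrDl mulrDr; congr (_ + _); rewrite mulrCA.
Qed.

(** This is 2 B (w B') = w (B^2)': adding the sum to its reversal turns the weights n - k and k into
    n. *)
Lemma wconv_sym n : 2 * wconv b n = n%:R * conv b n.
Proof.
rewrite mulr_natl mulr2n {1}/wconv (reindex_inj rev_ord_inj)/= /wconv.
rewrite -big_split/= mulr_sumr; apply: eq_bigr => k _.
have kn : (k <= n)%N by rewrite -ltnS.
rewrite subSS subKn// natrB//; ring.
Qed.

(** The two previous identities amount to (1 - w) (B^2)' = B^2, solved with constant term 1 by 1 /
    (1 - w). *)
Lemma conv_half n : conv b n = 1.
Proof.
elim: n => [|n IH]; first by rewrite /conv big_ord1 subn0 b0 mulr1.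
have n0 : n.+1%:R != 0 :> F by rewrite pnatr_eq0.
apply: (mulfI n0); rewrite -wconv_sym wconvS mulrDr wconv_sym IH.
by rewrite !mulr1 divff ?natr1// pnatr_eq0.
Qed.

Lemma conv_half_weighted (x : F) (g : nat -> F) n :
    (forall k, (x + k%:R) * g k = x) ->
  (n.+1%:R + x) * conv (fun k => b k * g k) n.+1 =
  (n%:R + x + 2^-1) * conv (fun k => b k * g k) n.
Proof.
move=> gE; set c := fun k => _.
(* Write m + x = (m - k) + (x + k) in the k-th summand: by [gE] the second part contributes x times
   [conv b m], which is 1. As x does not depend on m, the recurrence of [wconv] carries over. *)
have split_conv m : (m%:R + x) * conv c m = x + wconv c m.
  transitivity (x * conv b m + wconv c m); last by rewrite conv_half mulr1.
  rewrite /conv /wconv !mulr_sumr -big_split/=.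
  apply: eq_bigr => k _.
  have km : (k <= m)%N by rewrite -ltnS.
  have -> : m%:R = (m - k)%:R + k%:R :> F by rewrite -natrD subnK.
  by rewrite -[X in _ = X * _ + _](gE k) /c; ring.
by rewrite split_conv wconvS addrA -split_conv [RHS]mulrDl.
Qed.

(** Both sides equal 1 at n = 0 and are multiplied by (x + 1/2 + n) / (x + 1 + n) at each step. *)
Lemma conv_half_rising (x : F) (g : nat -> F) n :
    g 0 = 1 -> (forall k, (x + k%:R) * g k = x) ->
    (forall k, x + 1 + k%:R != 0) ->
  conv (fun k => b k * g k) n =
  \prod_(k < n) (x + 2^-1 + k%:R) / \prod_(k < n) (x + 1 + k%:R).
Proof.
move=> g0 gE x1; elim: n => [|n IH].
  by rewrite /conv big_ord1 !big_ord0 subn0 b0 g0 !mulr1 divr1.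
have y0 : n.+1%:R + x != 0 by rewrite -natr1 addrC addrA addrAC.
apply: (mulfI y0); rewrite conv_half_weighted// IH !big_ord_recr/=.
set p := \prod_(_ < _) _; set q := \prod_(_ < _) _.
have q0 : q != 0 by apply/prodf_neq0.
by rewrite -natr1; field; rewrite q0 x1.
Qed.

End HalfConvolution.

(** * A polynomial factor against geometric decay *)

Section RealSequences.
Context {R : realType}.
Implicit Types r : R.

Lemma sqr_natr_mul_expr_cvg0 r : 0 <= r < 1 ->
  n%:R ^+ 2 * r ^+ n @[n --> \oo] --> (0 : R).
Proof.
move=> /andP[r0 r1].
(* With a fourth root, r^n = (t^n)^2 (t^2)^n: each factor n is absorbed by one t^n, and (t^2)^n
   still tends to 0. *)
pose t := Num.sqrt (Num.sqrt r).
have t0 : 0 <= t by exact: sqrtr_ge0.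
have t4 : r = t ^+ 4.
  by rewrite (exprM _ 2 2) !sqr_sqrtr ?sqrtr_ge0.
have t1 : t < 1 by rewrite -(@ltr_pXn2r _ 4)// ?nnegrE// expr1n -t4.
(* (1 - t) n t^n is at most (1 - t) (1 + t + ... + t^(n-1)) = 1 - t^n. *)
have bnd n : n%:R * t ^+ n <= (1 - t)^-1.
  suff : n%:R * t ^+ n * (1 - t) <= 1 - t ^+ n.
    move=> h; rewrite -[leRHS]mul1r ler_pdivlMr ?subr_gt0//; apply: le_trans h _.
    by rewrite gerBl exprn_ge0.
  elim: n => [|n IH]; first by rewrite !mul0r expr0 subrr.
  have p1 : 0 <= (1 - t) * (1 - t ^+ n.+1).
    by rewrite mulr_ge0 ?subr_ge0 ?exprn_ile1 ?(ltW t1).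
  have p2 : 0 <= t * (1 - t ^+ n - n%:R * t ^+ n * (1 - t)).
    by rewrite mulr_ge0// subr_ge0.
  by rewrite -natr1; move: p1 p2; rewrite exprS; lra.
have h : (1 - t) ^- 2 * (t ^+ 2) ^+ n @[n --> \oo] --> (0 : R).
  rewrite -[X in _ --> X](mulr0 ((1 - t) ^- 2)); apply: cvgMr.
  by apply: cvg_expr; rewrite ger0_norm ?exprn_ge0// expr_lt1.
apply: (squeeze_cvgr _ (cvg_cst _) h); near=> n.
rewrite mulr_ge0 ?sqr_ge0 ?exprn_ge0//=.
have -> : r ^+ n = (t ^+ n) ^+ 2 * (t ^+ 2) ^+ n.
  by rewrite [in LHS]t4 -!exprM -exprD (mulnC n) -mulnDl.
rewrite mulrA -exprMn -exprVn ler_wpM2r ?exprn_ge0//.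
by rewrite ler_pXn2r ?nnegrE ?invr_ge0 ?subr_ge0 ?(ltW t1) ?mulr_ge0 ?exprn_ge0.
Unshelve. all: by end_near. Qed.

End RealSequences.

(** * Complex series with geometric bounds and their Cauchy products *)

Section ComplexSeries.
Context {R : realType}.
Implicit Types (u v : nat -> R[i]^o) (l z w : R[i]).
Local Notation Re := (@complex.Re R).
Local Notation Im := (@complex.Im R).

Lemma normcR (x : R) : `|x%:C| = `|x|%:C :> R[i].
Proof. by rewrite normc_def/= expr0n addr0 sqrtr_sqr. Qed.

Lemma ReD z w : Re (z + w) = Re z + Re w. Proof. by case: z w => [? ?] []. Qed.
Lemma ImD z w : Im (z + w) = Im z + Im w. Proof. by case: z w => [? ?] []. Qed.
Lemma ReB z w : Re (z - w) = Re z - Re w. Proof. by case: z w => [? ?] []. Qed.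

Lemma normr_Re_le (z : R[i]) (x : R) : `|z| <= x%:C -> `|Re z| <= x.
Proof. by move=> h; rewrite -lecR; exact: le_trans (normc_ge_Re z) h. Qed.

Lemma normr_Im_le (z : R[i]) (x : R) : `|z| <= x%:C -> `|Im z| <= x.
Proof.
move=> h; have := @normr_Re_le (z * 'i) x.
rewrite ReiNIm normrN normrM.
have -> : `|'i| = 1 :> R[i] by rewrite normc_def/= expr0n expr1n add0r sqrtr1.
by rewrite mulr1; exact.
Qed.

Lemma complex_gt0_real (e : R[i]) : 0 < e -> exists2 x : R, 0 < x & e = x%:C.
Proof.
case: e => a c; rewrite ltcE/= => /andP[/eqP -> a0].
by exists a.
Qed.

Lemma cvg_real_complex (u : nat -> R) (a : R) : u @ \oo --> a ->
  (fun n => (u n)%:C : R[i]^o) @ \oo --> (a%:C : R[i]^o).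
Proof.
move=> /cvgrPdist_lt ua; apply/cvgrPdist_lt => _ /complex_gt0_real[e e0 ->].
by apply: filterS (ua _ e0) => n; rewrite -rmorphB/= normcR ltcR.
Qed.

Lemma cvg_Re u l : u @ \oo --> (l : R[i]^o) -> Re (u n) @[n --> \oo] --> Re l.
Proof.
move=> /cvgrPdist_le ul; apply/cvgrPdist_le => e e0.
have e0' : 0 < e%:C :> R[i] by rewrite ltcR.
by apply: filterS (ul _ e0') => n h; rewrite -ReB; exact: normr_Re_le.
Qed.

(** Real and imaginary parts are separately dominated by a real geometric series. *)
Lemma series_cvg_geo u (M r : R) : 0 <= r < 1 ->
  (forall n, `|u n| <= (M * r ^+ n)%:C) -> cvgn (series u).
Proof.
move=> /andP[r0 r1] ub.
have aux (v : nat -> R) : (forall n, `|v n| <= M * r ^+ n) -> cvgn (series v).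
  move=> vb; apply: normed_cvg.
  apply: (@series_le_cvg _ _ (geometric M r)) => //.
  - by move=> n; rewrite /=.
  - by move=> n; apply: le_trans (normr_ge0 _) (vb n).
  - by apply: is_cvg_geometric_series; rewrite ger0_norm.
have hR : cvgn (series (fun n => Re (u n))).
  by apply: aux => n; exact: normr_Re_le.
have hI : cvgn (series (fun n => Im (u n))).
  by apply: aux => n; exact: normr_Im_le.
have -> : series u = (fun n => (series (Re \o u) n)%:C + 'i * (series (Im \o u) n)%:C).
  apply/funext => n; rewrite [LHS]complexE /series/=; congr (_%:C + _ * _%:C).
    by rewrite (big_morph Re ReD (erefl : Re 0 = 0)).
  by rewrite (big_morph Im ImD (erefl : Im 0 = 0)).
apply/cvg_ex; eexists; apply: cvgD; last apply: cvgMr.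
  by apply: cvg_real_complex; exact: hR.
by apply: cvg_real_complex; exact: hI.
Qed.

(** The triangle k + j < n is summed by antidiagonals on the left and by rows on the right. *)
Lemma series_cauchy_product (u v : nat -> R[i]) n :
  \sum_(m < n) \sum_(k < m.+1) u k * v (m - k)%N =
  \sum_(k < n) u k * \sum_(j < n - k) v j.
Proof.
elim: n => [|n IH]; first by rewrite !big_ord0.
rewrite big_ord_recr/= IH.
rewrite [RHS](eq_bigr (fun k : 'I_n.+1 =>
    u k * \sum_(j < n - k) v j + u k * v (n - k)%N)); last first.
  move=> k _; rewrite subSn; last by rewrite -ltnS.
  by rewrite big_ord_recr/= mulrDr.
rewrite big_split/=; congr (_ + _).
by rewrite big_ord_recr/= subnn big_ord0 mulr0 addr0.
Qed.

Lemma cvg_cauchy_product u v (A B : R[i]^o) (M N r : R) : 0 <= r < 1 ->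
    (forall n, `|u n| <= (M * r ^+ n)%:C) ->
    (forall n, `|v n| <= (N * r ^+ n)%:C) ->
    series u @ \oo --> A -> series v @ \oo --> B ->
  series (fun n => \sum_(k < n.+1) u k * v (n - k)%N : R[i]^o) @ \oo -->
  (A * B : R[i]^o).
Proof.
move=> /andP[r0 r1] ub vb uA vB.
(* [E n] collects the products u_k v_j with k, j < n and k + j >= n: at most n^2 terms, each of norm
   at most M N r^n. *)
pose E n : R[i]^o := series u n * series v n -
  series (fun n => \sum_(k < n.+1) u k * v (n - k)%N) n.
have -> : series (fun n => \sum_(k < n.+1) u k * v (n - k)%N : R[i]^o) =
    (fun n => series u n * series v n - E n) by apply/funext => n; rewrite /E subKr.
rewrite -[A * B]subr0; apply: cvgB; first exact: cvgM.
have M0 : 0 <= M.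
  by have := ub 0%N; rewrite expr0 mulr1 => /(le_trans (normr_ge0 _)); rewrite ler0c.
have N0 : 0 <= N.
  by have := vb 0%N; rewrite expr0 mulr1 => /(le_trans (normr_ge0 _)); rewrite ler0c.
have Eb n : `|E n| <= (M * N * (n%:R ^+ 2 * r ^+ n))%:C.
  rewrite /E /series/= !big_mkord series_cauchy_product mulr_suml -sumrB.
  apply: le_trans (ler_norm_sum _ _ _) _.
  apply: (@le_trans _ _ (\sum_(k < n) (M * N * (n%:R * r ^+ n))%:C)); last first.
    by rewrite sumr_const card_ord -rmorphMn/= lecR -mulr_natl; lra.
  apply: ler_sum => k _; rewrite -mulrBr normrM.
  have kn : (k <= n)%N by rewrite ltnW.
  rewrite [\sum_(i < n) v i](_ : _ =
      \sum_(i < n - k) v i + \sum_(n - k <= i < n) v i); last first.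
    by rewrite -!(big_mkord xpredT v) -big_cat_nat//= leq_subr.
  rewrite addrAC subrr add0r.
  apply: (@le_trans _ _ ((M * r ^+ k)%:C * (k%:R * (N * r ^+ (n - k)))%:C)).
    apply: ler_pM => //; apply: le_trans (ler_norm_sum _ _ _) _.
    apply: (@le_trans _ _ (\sum_(n - k <= i < n) (N * r ^+ (n - k))%:C)); last first.
      by rewrite sumr_const_nat subKn// -rmorphMn/= mulr_natl.
    rewrite big_nat_cond [leRHS]big_nat_cond; apply: ler_sum => i.
    rewrite andbT => /andP[ni _]; apply: le_trans (vb i) _; rewrite lecR.
    by rewrite ler_wpM2l// ler_wiXn2l// ltW.
  rewrite -rmorphM/= lecR.
  rewrite (_ : M * r ^+ k * (k%:R * (N * r ^+ (n - k))) =
    M * N * (k%:R * (r ^+ (n - k) * r ^+ k))); last by ring.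
  rewrite -exprD subnK// ler_wpM2l ?mulr_ge0// ler_wpM2r ?exprn_ge0//.
  by rewrite ler_nat.
have E0 : (M * N * (n%:R ^+ 2 * r ^+ n)) @[n --> \oo] --> (0 : R).
  rewrite -[X in _ --> X](mulr0 (M * N)); apply: cvgMr.
  by apply: sqr_natr_mul_expr_cvg0; rewrite r0.
apply/cvgr0Pnorm_le => _ /complex_gt0_real[e e0 ->].
move/cvgr0Pnorm_le : E0 => /(_ _ e0); apply: filterS => n h.
by apply: le_trans (Eb n) _; rewrite lecR; apply: le_trans (ler_norm _) h.
Qed.

End ComplexSeries.

(** * Principal logarithm, powers and square root *)

Section ComplexPowers.
Context {R : realType}.
Implicit Types (z w : R[i]) (x : R).
Local Notation Re := (@complex.Re R).
Local Notation Im := (@complex.Im R).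

Lemma cexpD z w : cexp (z + w) = cexp z * cexp w.
Proof.
case: z w => [a b] [c d]; rewrite /cexp/= expRD cosD sinD.
by apply/eqP; rewrite eq_complex/=; apply/andP; split; apply/eqP; ring.
Qed.

Lemma cexp_real x : cexp x%:C = (expR x)%:C.
Proof. by rewrite /cexp/= cos0 sin0 mulr1. Qed.

Lemma cexpMn z n : cexp (n%:R * z) = cexp z ^+ n.
Proof.
elim: n => [|n IH]; first by rewrite mul0r (cexp_real 0) expR0.
by rewrite -natr1 mulrDl mul1r cexpD IH exprSr.
Qed.

Lemma Re_norm_gt0 z : z != 0 -> 0 < Re `|z|.
Proof. by rewrite -normr_gt0 ltcE => /andP[]. Qed.

Lemma Re_norm_sq z : Re `|z| ^+ 2 = Re z ^+ 2 + Im z ^+ 2.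
Proof. by rewrite normc_def/= sqr_sqrtr// addr_ge0 ?sqr_ge0. Qed.

Lemma Re_div_norm z : z != 0 -> -1 <= Re z / Re `|z| <= 1.
Proof.
move=> z0; have m0 := Re_norm_gt0 _ z0.
rewrite ler_pdivrMr// ler_pdivlMr// mulN1r mul1r -ler_norml.
rewrite -(@ler_pXn2r _ 2)// ?nnegrE ?(ltW m0)// real_normK ?num_real//.
by rewrite Re_norm_sq lerDl sqr_ge0.
Qed.

Lemma cexp_clog z : z != 0 -> cexp (clog z) = z.
Proof.
move=> z0; have m0 := Re_norm_gt0 _ z0; have hz := Re_div_norm _ z0.
rewrite /cexp /clog/= lnK ?posrE//.
have e1 : cos (carg z) = Re z / Re `|z|.
  by rewrite /carg; case: ifP => _; rewrite ?cosN acosK// in_itv.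
(* The sine of the arccosine only yields |Im z| / |z|; the case distinction in [carg] restores the
   sign of Im z. *)
have e2 : sin (carg z) = Im z / Re `|z|.
  have e : Num.sqrt (1 - (Re z / Re `|z|) ^+ 2) = `|Im z| / Re `|z|.
    rewrite -[RHS]ger0_norm ?divr_ge0 ?(ltW m0)// -[RHS]sqrtr_sqr; congr Num.sqrt.
    rewrite !exprMn real_normK ?num_real// exprVn.
    have -> : Im z ^+ 2 = Re `|z| ^+ 2 - Re z ^+ 2 by rewrite Re_norm_sq; ring.
    by rewrite mulrBl divff// expf_neq0// gt_eqF.
  rewrite /carg; case: ifPn => h; rewrite ?sinN sin_acos// e.
    by rewrite ger0_norm.
  by rewrite ler0_norm ?mulNr ?opprK// ltW// ltNge.
rewrite e1 e2; apply/eqP; rewrite eq_complex/= !mul0r subr0 addr0.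
have m1 : Normc.normc z != 0 by rewrite gt_eqF//; exact: m0.
by rewrite !(mulrCA (Normc.normc z)) divff// !mulr1 !eqxx.
Qed.

Lemma cpow1 z : cpow z 1 = z.
Proof.
rewrite /cpow; have [->|z0] := eqVneq z 0; first by rewrite oner_eq0.
by rewrite mul1r cexp_clog.
Qed.

Lemma sqr_csqrt z : z != 0 -> csqrt z ^+ 2 = z.
Proof.
move=> z0; rewrite /csqrt /cpow (negbTE z0) -cexpMn mulrA.
have -> : 2 * (2^-1)%:C = 1 :> R[i].
  by rewrite -(rmorph_nat (real_complex R)) -rmorphM/= divff.
by rewrite mul1r cexp_clog.
Qed.

(** Half the principal argument lies in [-pi/2, pi/2], where the cosine is nonnegative. *)
Lemma Re_csqrt_ge0 z : 0 <= Re (csqrt z).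
Proof.
rewrite /csqrt /cpow; have [_|z0] := eqVneq z 0.
  by case: eqP => _ /=; rewrite ?ler01.
rewrite /cexp/= !mul0r subr0 addr0 mulr_ge0 ?expR_ge0// cos_ge0_pihalf//.
have h : - pi <= carg z <= pi.
  have /acos_ge0 a0 := Re_div_norm _ z0; have /acos_lepi api := Re_div_norm _ z0.
  by have := pi_ge0 R; rewrite /carg; case: ifP => _ ?; apply/andP; split; lra.
by lra.
Qed.

(** A positive real factor leaves the principal argument unchanged, so no multiple of 2 pi i
    appears. *)
Lemma clogM2 z : z != 0 -> clog (2 * z) = (ln 2)%:C + clog z.
Proof.
move=> z0.
have n2 : `|2 * z| = 2 * `|z| by rewrite normrM ger0_norm.
have R2 (u : R[i]) : Re (2 * u) = 2 * Re u.
  by rewrite mulr_natl mulr2n ReD; ring.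
have I2 (u : R[i]) : Im (2 * u) = 2 * Im u.
  by rewrite mulr_natl mulr2n ImD; ring.
rewrite /clog n2 R2 lnM ?posrE ?Re_norm_gt0//.
rewrite /carg n2 !R2 I2 pmulr_rge0// -mulf_div divff// mul1r.
by apply/eqP; rewrite eq_complex/= add0r !eqxx.
Qed.

Lemma cpowM2 z (x : R) n : z != 0 ->
  cpow (2 * z) (2 * (n%:R + x))%:C =
  (4 `^ x)%:C * cpow z (2 * x)%:C * (4 ^+ n)%:C * (z ^+ 2) ^+ n.
Proof.
move=> z0; have z20 : 2 * z != 0 by rewrite mulf_neq0.
rewrite /cpow (negbTE z0) (negbTE z20).
(* The part 2n of the exponent gives an honest integer power of 2z; only the part 2x keeps the
   logarithm of z. *)
have -> : (2 * (n%:R + x))%:C * clog (2 * z) =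
   (n * 2)%:R * clog (2 * z) + ((2 * x * ln 2)%:C + (2 * x)%:C * clog z).
  rewrite clogM2// natrM -(rmorph_nat (real_complex R) n).
  by rewrite -(rmorph_nat (real_complex R) 2) !rmorphM !rmorphD/=; ring.
rewrite !cexpD cexpMn cexp_clog// cexp_real.
have -> : expR (2 * x * ln 2) = 4 `^ x.
  rewrite /powR gt_eqF// (_ : 4 = 2 ^+ 2); last by ring.
  by rewrite lnXn//; congr expR; ring.
rewrite mulnC exprM exprMn_comm ?exprMn; last exact: mulrC.
have -> : (4 ^+ n)%:C = 2 ^+ n * 2 ^+ n :> R[i].
  by rewrite -exprMn -natrM rmorphXn/= (rmorph_nat (real_complex R) 4).
by ring.
Qed.

End ComplexPowers.

(** * The binomial series of (1 - w)^(-1/2) *)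

Section InverseSquareRoot.
Context {R : realType}.
Implicit Types (w B : R[i]).
Local Notation Re := (@complex.Re R).

Definition half_coef (n : nat) : R := \prod_(k < n) (2^-1 + k%:R) / n`!%:R.

Lemma half_coef0 : half_coef 0 = 1.
Proof. by rewrite /half_coef big_ord0 divr1. Qed.

Lemma half_coefS n : n.+1%:R * half_coef n.+1 = (n%:R + 2^-1) * half_coef n.
Proof.
rewrite /half_coef big_ord_recr/= factS natrM; field.
by rewrite pnatr_eq0 -lt0n fact_gt0 addrC natr1 pnatr_eq0.
Qed.

Lemma half_coef_ge0 n : 0 <= half_coef n.
Proof. by rewrite divr_ge0// prodr_ge0// => i _; rewrite addr_ge0. Qed.

Lemma half_coef_le n : half_coef n.+1 <= half_coef n.
Proof.
have n0 : 0 < n.+1%:R :> R by [].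
rewrite -(ler_pM2l n0) half_coefS; apply: ler_wpM2r; first exact: half_coef_ge0.
by rewrite -[n.+1%:R]natr1 lerD2l invf_le1 ?ler1n.
Qed.

Lemma half_coef_le1 n : half_coef n <= 1.
Proof.
elim: n => [|n]; first by rewrite half_coef0.
by apply: le_trans; exact: half_coef_le.
Qed.

Lemma half_coef_term_le w (r : R) n : `|w| = r%:C ->
  `|(half_coef n)%:C * w ^+ n| <= (1 * r ^+ n)%:C.
Proof.
move=> wr; have r0 : 0 <= r by rewrite -ler0c -wr.
rewrite normrM normcR normrX wr -rmorphXn -rmorphM/= lecR.
by rewrite ger0_norm ?half_coef_ge0// ler_wpM2r ?exprn_ge0// half_coef_le1.
Qed.

(* By summation by parts, (1 - w) S_n is 1 minus a combination of powers of w
   with nonnegative coefficients b_{k-1} - b_k and b_n adding up to 1; this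
   keeps its real part away from 0 and so selects the branch of the root. *)
Lemma half_series_bound w (r : R) n : `|w| = r%:C -> r <= 1 ->
  `|1 - (1 - w) * \sum_(k < n.+1) (half_coef k)%:C * w ^+ k| <= r%:C.
Proof.
move=> wr r_le1.
pose T n := 1 - (1 - w) * \sum_(k < n.+1) (half_coef k)%:C * w ^+ k -
  (half_coef n)%:C * w ^+ n.+1.
have r0 : 0 <= r by rewrite -ler0c -wr.
have r1 m : r ^+ m.+1 <= r by rewrite exprS ler_piMr// exprn_ile1.
have Tn m : `|T m| <= (r * (1 - half_coef m))%:C.
  elim: m => [|m IH].
    have -> : T 0%N = 0 by rewrite /T big_ord1 half_coef0 rmorph1 expr0 expr1; ring.
    by rewrite normr0 half_coef0 subrr mulr0.
  have -> : T m.+1 = T m + (half_coef m - half_coef m.+1)%:C * w ^+ m.+1.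
    rewrite /T [in LHS]big_ord_recr/= rmorphB/= !exprS.
    set S := \sum_(_ < _) _; ring.
  apply: le_trans (ler_normD _ _) _.
  have -> : r * (1 - half_coef m.+1) =
    r * (1 - half_coef m) + (half_coef m - half_coef m.+1) * r by ring.
  rewrite [leRHS]rmorphD/=; apply: lerD => //.
  rewrite normrM normcR normrX wr -rmorphXn -rmorphM/= lecR.
  by rewrite ger0_norm ?subr_ge0 ?half_coef_le// ler_wpM2l ?subr_ge0 ?half_coef_le.
have -> : 1 - (1 - w) * \sum_(k < n.+1) (half_coef k)%:C * w ^+ k =
  T n + (half_coef n)%:C * w ^+ n.+1 by rewrite /T subrK.
apply: le_trans (ler_normD _ _) _.
have -> : r = r * (1 - half_coef n) + half_coef n * r by ring.
rewrite [leRHS]rmorphD/=; apply: lerD => //.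
rewrite normrM normcR normrX wr -rmorphXn -rmorphM/= lecR.
by rewrite ger0_norm ?half_coef_ge0// ler_wpM2l ?half_coef_ge0.
Qed.


Lemma half_series_sum w B (r : R) : `|w| = r%:C -> r < 1 ->
  series (fun n => (half_coef n)%:C * w ^+ n : R[i]^o) @ \oo --> (B : R[i]^o) ->
  B = (csqrt (1 - w))^-1.
Proof.
move=> wr r1 sB.
have r0 : 0 <= r by rewrite -ler0c -wr.
have w1 : 1 - w != 0.
  rewrite subr_eq0; apply/eqP => w1; move: r1.
  by rewrite -ltcR -wr -w1 normr1 ltxx.
have fb n : `|(half_coef n)%:C * w ^+ n| <= (1 * r ^+ n)%:C by exact: half_coef_term_le.
(* By [conv_half] the Cauchy square of the series is the geometric series. *)
have BB : (1 - w) * (B * B) = 1.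
  have r01 : 0 <= r < 1 by rewrite r0.
  have := cvg_cauchy_product _ _ _ _ _ _ _ r01 fb fb sB sB.
  have -> : (fun n => \sum_(k < n.+1) (half_coef k)%:C * w ^+ k *
       ((half_coef (n - k)%N)%:C * w ^+ (n - k)%N) : R[i]^o) =
     (fun n => w ^+ n : R[i]^o).
    apply/funext => n.
    transitivity ((\sum_(k < n.+1) half_coef k * half_coef (n - k)%N)%:C * w ^+ n).
      rewrite rmorph_sum/= mulr_suml; apply: eq_bigr => k _.
      have kn : (k <= n)%N by rewrite -ltnS.
      have -> : w ^+ n = w ^+ k * w ^+ (n - k) by rewrite -exprD subnKC.
      by rewrite [in RHS]rmorphM/=; ring.
    by rewrite (conv_half _ half_coef0 half_coefS) mul1r.
  move=> sBB.
  have h : (fun n => (1 - w) * series (fun n => w ^+ n : R[i]^o) n : R[i]^o) @ \oo -->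
      ((1 - w) * (B * B) : R[i]^o) by apply: cvgMr; exact: sBB.
  have haus := @norm_hausdorff _ (R[i]^o).
  rewrite -(cvg_lim haus h); apply: (cvg_lim haus).
  apply/cvgrPdist_le => _ /complex_gt0_real[e e0 ->].
  have : (fun n => r ^+ n) @ \oo --> (0 : R) by apply: cvg_expr; rewrite ger0_norm.
  move=> /cvgr0Pnorm_le /(_ _ e0); apply: filterS => n rn.
  rewrite /series/= big_mkord.
  have -> : (1 - w) * \sum_(k < n) w ^+ k = 1 - w ^+ n.
    by rewrite -[1 in RHS](expr1n _ n) subrXX -[RHS]/(_ * _); congr (_ * _);
       apply: eq_bigr => i _; rewrite expr1n mul1r.
  rewrite subKr normrX wr -rmorphXn/= lecR.
  by apply: le_trans rn; exact: ler_norm.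
(* The bound on partial sums keeps the real part at least 1 - r, uniformly in n, hence also in the
   limit. *)
have Re_pos : 0 < Re ((1 - w) * B).
  have h : Re ((1 - w) * \sum_(k < n.+1) (half_coef k)%:C * w ^+ k) @[n --> \oo]
      --> Re ((1 - w) * B).
    apply: (@cvg_Re _ (fun n => (1 - w) * \sum_(k < n.+1) (half_coef k)%:C * w ^+ k)).
    apply: cvgMr.
    move: sB; rewrite -cvg_shiftS; apply: cvg_trans; apply: near_eq_cvg.
    by near=> n; rewrite /series/= big_mkord.
  apply: (@lt_le_trans _ _ (1 - r)); first by rewrite subr_gt0.
  apply: (@cvgr_to_ge _ _ _ _ _ _ _ h); near=> n.
  have /normr_Re_le := half_series_bound _ _ n wr (ltW r1).
  by rewrite ReB ler_norml/= => /andP[_]; lra.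
have c0 : csqrt (1 - w) != 0.
  apply/eqP => c0; have e := sqr_csqrt _ w1.
  by move: w1; rewrite -e c0 expr0n eqxx.
(* Both are square roots of 1 - w, hence equal up to sign; the signs of the real parts exclude the
   minus. *)
have : ((1 - w) * B) ^+ 2 == csqrt (1 - w) ^+ 2.
  by rewrite sqr_csqrt// exprMn expr2 -mulrA -[B ^+ 2]/(B * B) BB mulr1.
rewrite eqf_sqr => /orP[] /eqP e; last first.
  exfalso; have := Re_csqrt_ge0 (1 - w); move: Re_pos; rewrite e.
  by case: (csqrt _) => b c /=; rewrite oppr_gt0 ltNge => /negP.
apply: (mulfI c0); rewrite divff// -[RHS]BB mulrA e; congr (_ * _).
Unshelve. all: by end_near. Qed.

End InverseSquareRoot.

(** * Central binomials and the coefficients of the two series *)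

Section CentralBinomial.
Context {R : realType}.
Implicit Types (a x : R).

(** The excluded half-integers keep both Gamma arguments a + 1 and 2a + 1 off the poles. *)
Lemma gbinom_central_neq0 a : (forall k : nat, a <> - (k%:R / 2)) ->
  gbinom (2 * a) a != 0.
Proof.
move=> ha; rewrite /gbinom.
have e : 2 * a - a = a by ring.
have h1 (m : nat) : a + 1 <> - m%:R.
  have e2 : m.+1.*2%:R = 2 * (m%:R + 1) :> R by rewrite -mul2n natrM natr1.
  by move=> h; apply: (ha m.+1.*2); rewrite e2; lra.
have h2 (m : nat) : 2 * a + 1 <> - m%:R.
  by move=> h; apply: (ha m.+1); rewrite -natr1; lra.
have g1 := Gamma_neq0 _ h1; have g2 := Gamma_neq0 _ h2.
by rewrite e mulf_neq0// invr_eq0 mulf_neq0.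
Qed.

Lemma gbinom_centralS a : (forall k : nat, a <> - (k%:R / 2)) ->
  gbinom (2 * (a + 1)) (a + 1) = gbinom (2 * a) a * (2 * (2 * a + 1) / (a + 1)).
Proof.
move=> ha.
have e (b : R) : 2 * b - b = b by ring.
rewrite /gbinom !e.
have h1 (m : nat) : a + 1 <> - m%:R.
  have e2 : m.+1.*2%:R = 2 * (m%:R + 1) :> R by rewrite -mul2n natrM natr1.
  by move=> h; apply: (ha m.+1.*2); rewrite e2; lra.
have h2 (m : nat) : 2 * a + 1 <> - m%:R.
  by move=> h; apply: (ha m.+1); rewrite -natr1; lra.
have h3 (m : nat) : 2 * a + 1 + 1 <> - m%:R.
  by move=> h; apply: (ha m.+2); rewrite -addn2 natrD; lra.
have -> : 2 * (a + 1) + 1 = 2 * a + 1 + 1 + 1 by ring.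
rewrite (GammaS _ h3) (GammaS _ h2) (GammaS _ h1).
have g1 := Gamma_neq0 _ h1.
have a1 : a + 1 != 0 by apply/eqP; rewrite -oppr0; exact: (h1 0).
by field; rewrite g1 a1.
Qed.

(** With y = n + a, [gbinom_centralS] makes the ratio of consecutive left-hand sides 4y / (2 (2y +
    1)) = y / (y + 1/2). *)
Lemma HCB_coefE a n : (forall k : nat, a <> - (k%:R / 2)) ->
  4 ^+ n / (gbinom (2 * (n%:R + a)) (n%:R + a) * (n%:R + a)) =
  (\prod_(k < n) (a + k%:R) / \prod_(k < n) (a + 2^-1 + k%:R)) /
  (gbinom (2 * a) a * a).
Proof.
move=> ha.
have hn m : forall k : nat, m%:R + a <> - (k%:R / 2).
  by move=> k h; apply: (ha (k + m.*2)%N); rewrite -mul2n natrD natrM; lra.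
have a0 m : m%:R + a != 0 by apply/eqP => h; apply: (hn m 0); lra.
have a2 m : a + 2^-1 + m%:R != 0 by apply/eqP => h; apply: (hn m 1); lra.
have gn0 m := gbinom_central_neq0 _ (hn m).
have := a0 0%N; rewrite add0r => an0.
have := gn0 0%N; rewrite add0r => g0.
elim: n => [|n IH]; first by rewrite !big_ord0 expr0 add0r divr1.
have e : n.+1%:R + a = n%:R + a + 1 by rewrite -natr1; ring.
rewrite e (gbinom_centralS _ (hn n)) exprS !big_ord_recr/=.
have := a0 n.+1; have := gn0 n; have := a0 n; have := a2 n; rewrite e.
move: IH; set p := \prod_(_ < n) _; set q := \prod_(_ < n) _.
have q0 : q != 0 by apply/prodf_neq0.
move=> IH b1 b2 b3 b4.
transitivity ((4 ^+ n / (gbinom (2 * (n%:R + a)) (n%:R + a) * (n%:R + a))) *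
   ((a + n%:R) / (a + 2^-1 + n%:R))).
  have b5 : 2 * (n%:R + a) + 1 != 0 by move: b1; apply: contra_neq; lra.
  have -> : a + 2^-1 + n%:R = (2 * (n%:R + a) + 1) / 2 by field.
  have -> : a + n%:R = n%:R + a by rewrite addrC.
  move: b2 b3 b4 b5; move: (n%:R + a) => y; move: (gbinom _ _) => u b2 b3 b4 b5.
  by field; rewrite b2 b3 b4 b5.
rewrite IH; move: (a + 2^-1 + n%:R) b1 (a + n%:R) => s s0 t.
by field; rewrite s0 q0 an0 g0.
Qed.

(** Telescoping: (x)_n (x + n) = (x)_(n+1) = x (x + 1)_n. *)
Lemma rising_ratioE x n : (forall k : nat, x + 1 + k%:R != 0) ->
  (x + n%:R) * (\prod_(k < n) (x + k%:R) / \prod_(k < n) (x + 1 + k%:R)) = x.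
Proof.
move=> x1; rewrite mulrA.
have -> : (x + n%:R) * \prod_(k < n) (x + k%:R) = \prod_(k < n.+1) (x + k%:R).
  by rewrite big_ord_recr/= mulrC.
rewrite big_ord_recl addr0 (eq_bigr (fun k : 'I_n => x + 1 + k%:R)); last first.
  by move=> k _; rewrite lift0 -natr1; ring.
by rewrite mulfK//; apply/prodf_neq0.
Qed.

Lemma rising_ratio_bounded x : (forall k : nat, x + 1 + k%:R != 0) ->
  exists2 M : R, 0 <= M & forall n : nat,
  `|\prod_(k < n) (x + k%:R) / \prod_(k < n) (x + 1 + k%:R)| <= M.
Proof.
move=> x1.
pose g (n : nat) := \prod_(k < n) (x + k%:R) / \prod_(k < n) (x + 1 + k%:R).
(* From [K] on, n > 2|x| gives |x + n| > |x|, so (x + n) g_n = x forces |g_n| <= 1; the finitely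
   many earlier terms are bounded by their sum. *)
pose K := (Num.truncn (2 * `|x|)).+1.
exists (1 + \sum_(k < K) `|g k|); first by rewrite addr_ge0// sumr_ge0.
move=> n; rewrite -/(g n); have [nK|Kn] := ltnP n K.
  rewrite (bigD1 (Ordinal nK))//= addrCA lerDl addr_ge0// sumr_ge0//.
apply: (@le_trans _ _ 1); last by rewrite lerDl sumr_ge0.
have nx : 2 * `|x| < n%:R.
  by apply: (lt_le_trans (truncnS_gt _)); rewrite ler_nat.
have xn : `|x| < `|x + n%:R|.
  have := ler_normD (x + n%:R) (- x); rewrite normrN addrAC subrr add0r.
  by rewrite normr_nat; lra.
have := congr1 Num.norm (rising_ratioE x n x1); rewrite normrM -/(g n) => e.
have xn0 : 0 < `|x + n%:R| by apply: le_lt_trans xn.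
by rewrite -(ler_pM2l xn0) e mulr1 ltW.
Qed.

Lemma HCB_termE a z n : (forall k : nat, a <> - (k%:R / 2)) ->
  HCB_term 1 a z n = (4 `^ a / (gbinom (2 * a) a * a))%:C * cpow z (2 * a)%:C *
   ((\prod_(k < n) (a + k%:R) / \prod_(k < n) (a + 2^-1 + k%:R))%:C *
    (z ^+ 2) ^+ n).
Proof.
move=> ha; rewrite /HCB_term cpow1.
(* At z = 0 both sides vanish, since the exponents 2(n + a) and 2a are nonzero; the case 0^0 = 1 of
   [cpow] does not arise. *)
have [->|z0] := eqVneq z 0.
  have nz (x : R) : x != 0 -> cpow 0 x%:C = 0 :> R[i].
    by move=> x0; rewrite /cpow eqxx (inj_eq (@complexI R) x 0) (negbTE x0).
  rewrite mulr0 !nz ?mulr0 ?mul0r//.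
    by apply/eqP => h; apply: (ha n.*2); rewrite -mul2n natrM; lra.
  by apply/eqP => h; apply: (ha 0); lra.
rewrite cpowM2//.
have -> : (4 `^ a / (gbinom (2 * a) a * a))%:C * cpow z (2 * a)%:C *
   ((\prod_(k < n) (a + k%:R) / \prod_(k < n) (a + 2^-1 + k%:R))%:C *
    (z ^+ 2) ^+ n) =
   (4 `^ a)%:C * cpow z (2 * a)%:C * (z ^+ 2) ^+ n *
   ((\prod_(k < n) (a + k%:R) / \prod_(k < n) (a + 2^-1 + k%:R)) /
    (gbinom (2 * a) a * a))%:C by rewrite !rmorphM/=; ring.
rewrite -HCB_coefE//; move: (gbinom _ _) => u; move: (n%:R + a) => y.
have -> : (4 ^+ n / (u * y))%:C = (4 ^+ n)%:C / (u%:C * y%:C).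
  by rewrite rmorphM/= fmorphV/= rmorphM.
by ring.
Qed.

Lemma hyp2F1_termE (x : R) (w : R[i]) n :
  hyp2F1_term 2^-1 x (x + 1) w n =
  (half_coef n * (\prod_(k < n) (x + k%:R) / \prod_(k < n) (x + 1 + k%:R)))%:C *
  w ^+ n.
Proof.
rewrite /hyp2F1_term !pochhammerE /half_coef; congr (_%:C * _).
by rewrite mulf_div [n`!%:R * _]mulrC.
Qed.

End CentralBinomial.

(** * Factorisation of the series as a Cauchy product *)

Theorem theorem3p1 (R : realType) (a : R) (z : R[i])
    (hz : `|z| < 1) (ha : forall k : nat, a <> - (k%:R / 2)) :
  [/\ cvgn (series (HCB_term 1 a z)),
      cvgn (series (hyp2F1_term 2^-1 (a - 2^-1) (a + 2^-1) (z ^+ 2)))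
    & Phi_HCB 1 a z =
      (4 `^ a / (gbinom (2 * a) a * a))%:C *
      (cpow z (2 * a)%:C / csqrt (1 - z ^+ 2)) *
      hyp2F1 2^-1 (a - 2^-1) (a + 2^-1) (z ^+ 2)].
Proof.
set w := z ^+ 2; set x := a - 2^-1.
have -> : a + 2^-1 = x + 1 by rewrite /x; lra.
(* A zero would mean a = -(2k + 1)/2, an excluded half-integer. *)
have x1 (k : nat) : x + 1 + k%:R != 0.
  apply/eqP => h; apply: (ha k.*2.+1); rewrite -natr1 -mul2n natrM.
  by move: h; rewrite /x; lra.
have [M M0 gM] := rising_ratio_bounded _ x1.
pose g n := \prod_(k < n) (x + k%:R) / \prod_(k < n) (x + 1 + k%:R).
have [r wr r1] : exists2 r : R, `|w| = r%:C & r < 1.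
  exists (complex.Re `|z| ^+ 2).
    by rewrite normrX rmorphXn/=; congr (_ ^+ 2); rewrite normc_def.
  rewrite expr_lt1//; first by move: hz; rewrite ltcE => /andP[].
  by have := normr_ge0 z; rewrite lecE => /andP[].
have r0 : 0 <= r by rewrite -ler0c -wr.
have r01 : 0 <= r < 1 by rewrite r0.
pose f n : R[i]^o := (half_coef n)%:C * w ^+ n.
pose h n : R[i]^o := (half_coef n * g n)%:C * w ^+ n.
have hE : hyp2F1_term 2^-1 x (x + 1) w = h.
  by apply/funext => n; rewrite hyp2F1_termE.
have fb n : `|f n| <= (1 * r ^+ n)%:C by exact: half_coef_term_le.
have hb n : `|h n| <= (M * r ^+ n)%:C.
  rewrite normrM normcR normrX wr -rmorphXn -rmorphM/= lecR ler_wpM2r ?exprn_ge0//.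
  rewrite normrM ger0_norm ?half_coef_ge0// -[M]mul1r.
  by rewrite ler_pM ?half_coef_ge0 ?half_coef_le1 ?gM.
have cf := series_cvg_geo _ _ _ r01 fb.
have ch := series_cvg_geo _ _ _ r01 hb.
have := half_series_sum _ _ _ wr r1 cf.
set B := limn _ => BE.
have hfE n : \sum_(k < n.+1) h k * f (n - k)%N =
   (\prod_(k < n) (a + k%:R) / \prod_(k < n) (a + 2^-1 + k%:R))%:C * w ^+ n.
  have ax : x + 2^-1 = a by rewrite /x; lra.
  have ax1 : x + 1 = a + 2^-1 by rewrite /x; lra.
  have := conv_half_rising _ half_coef0 half_coefS x g n.
  rewrite ax ax1 => <-; last 3 first.
  - by rewrite /g !big_ord0 divr1.
  - by move=> k; exact: rising_ratioE.
  - by move=> k; rewrite -ax1.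
  rewrite rmorph_sum/= mulr_suml; apply: eq_bigr => k _.
  have kn : (k <= n)%N by rewrite -ltnS.
  have -> : w ^+ n = w ^+ k * w ^+ (n - k) by rewrite -exprD subnKC.
  by rewrite /h /f [in RHS]rmorphM/=; ring.
have := cvg_cauchy_product _ _ _ _ _ _ _ r01 hb fb ch cf.
rewrite -/B; set H := limn _ => cH.
set c := (4 `^ a / (gbinom (2 * a) a * a))%:C * cpow z (2 * a)%:C.
(* By [hfE] the partial sums are [c] times those of the Cauchy product, whose limit is the
   hypergeometric value [H] times the inverse root [B]. *)
have cHCB : series (HCB_term 1 a z) @ \oo --> (c * (H * B) : R[i]^o).
  have -> : series (HCB_term 1 a z) =
    (fun n => c * series (fun n => \sum_(k < n.+1) h k * f (n - k)%N : R[i]^o) n).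
    apply/funext => n; rewrite /series/= mulr_sumr; apply: eq_bigr => k _.
    by rewrite hfE HCB_termE.
  by apply: cvgMr; exact: cH.
split.
- by apply/cvg_ex; exists (c * (H * B)).
- by rewrite hE.
- rewrite /Phi_HCB /hyp2F1 hE -/H (cvg_lim _ cHCB)// BE /c; ring.
Qed.
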